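(* Let $(L,[-,-,-]_1,[-,-,-]_2)$ be a compatible ternary Leibniz algebra and let $(M,l_1^i,l_2^i,l_3^i)$, $i=1,2$, be a compatible bimodule over $L$. Then the direct sum $L\oplus M$ has a compatible ternary Leibniz algebra structure with the multiplications $$[x+m_1,y+m_2,z+m_3]^i:=[x,y,z]_i+l_1^i(m_1,y,z)+l_2^i(x,m_2,z)+l_3^i(x,y,m_3),\qquad i=1,2,$$ for all $x,y,z\in L$ and $m_1,m_2,m_3\in M$.
   Context: Vector spaces are over a field $\mathbb{K}$. A ternary Leibniz algebra is a vector space $L$ with a trilinear map $[-,-,-]$ such that $[[x,y,z],t,u]=[x,y,[z,t,u]]+[x,[y,t,u],z]+[[x,t,u],y,z]$ for all $x,y,z,t,u\in L$. A compatible ternary Leibniz algebra is a triple $(L,[-,-,-]_1,[-,-,-]_2)$ where both $(L,[-,-,-]_i)$ are ternary Leibniz algebras and for all $x,y,z,t,u\in L$ $$[[x,y,z]_1,t,u]_2+[[x,y,z]_2,t,u]_1=[x,y,[z,t,u]_1]_2+[x,y,[z,t,u]_2]_1+[x,[y,t,u]_1,z]_2+[x,[y,t,u]_2,z]_1+[[x,t,u]_1,y,z]_2+[[x,t,u]_2,y,z]_1.$$ A bimodule over a ternary Leibniz algebra $L$ is a vector space $M$ with trilinear maps $l_1:M\times L\times L\to M$, $l_2:L\times M\times L\to M$, $l_3:L\times L\times M\to M$ such that for all $x,y,z,t\in L$, $m\in M$: $$l_1(l_1(m,x,y),z,t)=l_1(m,x,[y,z,t])+l_1(m,[x,z,t],y)+l_1(l_1(m,z,t),x,y),$$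 $$l_1(l_2(x,m,y),z,t)=l_2(x,m,[y,z,t])+l_2(x,l_1(m,z,t),y)+l_2([x,z,t],m,y),$$ $$l_1(l_3(x,y,m),z,t)=l_3(x,y,l_1(m,z,t))+l_3(x,[y,z,t],m)+l_3([x,z,t],y,m),$$ $$l_2([x,y,z],m,t)=l_3(x,y,l_2(z,m,t))+l_2(x,l_2(y,m,t),z)+l_1(l_2(x,m,t),y,z),$$ $$l_3([x,y,z],t,m)=l_3(x,y,l_3(z,t,m))+l_2(x,l_3(y,t,m),z)+l_1(l_3(x,t,m),y,z).$$ A compatible bimodule over $(L,[-,-,-]_1,[-,-,-]_2)$ is a vector space $M$ with trilinear maps $l_1^j:M\times L\times L\to M$, $l_2^j:L\times M\times L\to M$, $l_3^j:L\times L\times M\to M$ ($j=1,2$) such that $(M,l_1^j,l_2^j,l_3^j)$ is a bimodule over $(L,[-,-,-]_j)$ for $j=1,2$, and for all $x,y,z,t\in L$, $m\in M$: $$l_1^2(l_1^1(m,x,y),z,t)+l_1^1(l_1^2(m,x,y),z,t)=l_1^2(m,x,[y,z,t]_1)+l_1^1(m,x,[y,z,t]_2)+l_1^2(m,[x,z,t]_1,y)+l_1^1(m,[x,z,t]_2,y)+l_1^2(l_1^1(m,z,t),x,y)+l_1^1(l_1^2(m,z,t),x,y),$$ $$l_1^2(l_2^1(x,m,y),z,t)+l_1^1(l_2^2(x,m,y),z,t)=l_2^2(x,m,[y,z,t]_1)+l_2^1(x,m,[y,z,t]_2)+l_2^2(x,l_1^1(m,z,t),y)+l_2^1(x,l_1^2(m,z,t),y)+l_2^2([x,z,t]_1,m,y)+l_2^1([x,z,t]_2,m,y),$$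 $$l_1^2(l_3^1(x,y,m),z,t)+l_1^1(l_3^2(x,y,m),z,t)=l_3^2(x,y,l_1^1(m,z,t))+l_3^1(x,y,l_1^2(m,z,t))+l_3^2(x,[y,z,t]_1,m)+l_3^1(x,[y,z,t]_2,m)+l_3^2([x,z,t]_1,y,m)+l_3^1([x,z,t]_2,y,m),$$ $$l_2^2([x,y,z]_1,m,t)+l_2^1([x,y,z]_2,m,t)=l_3^2(x,y,l_2^1(z,m,t))+l_3^1(x,y,l_2^2(z,m,t))+l_2^2(x,l_2^1(y,m,t),z)+l_2^1(x,l_2^2(y,m,t),z)+l_1^2(l_2^1(x,m,t),y,z)+l_1^1(l_2^2(x,m,t),y,z),$$ $$l_3^2([x,y,z]_1,t,m)+l_3^1([x,y,z]_2,t,m)=l_3^2(x,y,l_3^1(z,t,m))+l_3^1(x,y,l_3^2(z,t,m))+l_2^2(x,l_3^1(y,t,m),z)+l_2^1(x,l_3^2(y,t,m),z)+l_1^2(l_3^1(x,t,m),y,z)+l_1^1(l_3^2(x,t,m),y,z).$$ *)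

(* Defs.v *)
From HB Require Import structures.
From mathcomp Require Import all_boot all_order all_algebra.

Set Implicit Arguments.
Unset Strict Implicit.
Unset Printing Implicit Defensive.

Import GRing.Theory.
Local Open Scope ring_scope.

(* Vector spaces over a field K, of arbitrary dimension, are [lmodType K].
   In names of the form [lk_j] below, k = 1, 2, 3 is the slot of the module
   element and j = 1, 2 says which of the two brackets is concerned. *)

Definition trilinear (K : fieldType) (U V W X : lmodType K)
    (f : U -> V -> W -> X) : Prop :=
  [/\ forall v w, linear (fun u => f u v w),
      forall u w, linear (fun v => f u v w)
    & forall u v, linear (fun w => f u v w)].

Record ternary_leibniz (K : fieldType) (L : lmodType K)
    (br : L -> L -> L -> L) : Prop := TernaryLeibniz {
  leibniz_trilinear : trilinear br;
  leibniz_identity : forall x y z t u : L,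
    br (br x y z) t u =
    br x y (br z t u) + br x (br y t u) z + br (br x t u) y z
}.

Record compatible_ternary_leibniz (K : fieldType) (L : lmodType K)
    (br_1 br_2 : L -> L -> L -> L) : Prop := CompatibleTernaryLeibniz {
  compat_leibniz_1 : ternary_leibniz br_1;
  compat_leibniz_2 : ternary_leibniz br_2;
  compat_leibniz_identity : forall x y z t u : L,
    br_2 (br_1 x y z) t u + br_1 (br_2 x y z) t u =
    br_2 x y (br_1 z t u) + br_1 x y (br_2 z t u) +
    br_2 x (br_1 y t u) z + br_1 x (br_2 y t u) z +
    br_2 (br_1 x t u) y z + br_1 (br_2 x t u) y z
}.

Record leibniz_bimodule (K : fieldType) (L M : lmodType K)
    (br : L -> L -> L -> L)
    (l1 : M -> L -> L -> M) (l2 : L -> M -> L -> M) (l3 : L -> L -> M -> M)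
    : Prop := LeibnizBimodule {
  bimod_trilinear1 : trilinear l1;
  bimod_trilinear2 : trilinear l2;
  bimod_trilinear3 : trilinear l3;
  bimod_identity1 : forall (x y z t : L) (m : M),
    l1 (l1 m x y) z t =
    l1 m x (br y z t) + l1 m (br x z t) y + l1 (l1 m z t) x y;
  bimod_identity2 : forall (x y z t : L) (m : M),
    l1 (l2 x m y) z t =
    l2 x m (br y z t) + l2 x (l1 m z t) y + l2 (br x z t) m y;
  bimod_identity3 : forall (x y z t : L) (m : M),
    l1 (l3 x y m) z t =
    l3 x y (l1 m z t) + l3 x (br y z t) m + l3 (br x z t) y m;
  bimod_identity4 : forall (x y z t : L) (m : M),
    l2 (br x y z) m t =
    l3 x y (l2 z m t) + l2 x (l2 y m t) z + l1 (l2 x m t) y z;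
  bimod_identity5 : forall (x y z t : L) (m : M),
    l3 (br x y z) t m =
    l3 x y (l3 z t m) + l2 x (l3 y t m) z + l1 (l3 x t m) y z
}.

Record compatible_bimodule (K : fieldType) (L M : lmodType K)
    (br_1 br_2 : L -> L -> L -> L)
    (l1_1 : M -> L -> L -> M) (l2_1 : L -> M -> L -> M)
    (l3_1 : L -> L -> M -> M)
    (l1_2 : M -> L -> L -> M) (l2_2 : L -> M -> L -> M)
    (l3_2 : L -> L -> M -> M) : Prop := CompatibleBimodule {
  compat_bimod_1 : leibniz_bimodule br_1 l1_1 l2_1 l3_1;
  compat_bimod_2 : leibniz_bimodule br_2 l1_2 l2_2 l3_2;
  compat_bimod_identity1 : forall (x y z t : L) (m : M),
    l1_2 (l1_1 m x y) z t + l1_1 (l1_2 m x y) z t =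
    l1_2 m x (br_1 y z t) + l1_1 m x (br_2 y z t) +
    l1_2 m (br_1 x z t) y + l1_1 m (br_2 x z t) y +
    l1_2 (l1_1 m z t) x y + l1_1 (l1_2 m z t) x y;
  compat_bimod_identity2 : forall (x y z t : L) (m : M),
    l1_2 (l2_1 x m y) z t + l1_1 (l2_2 x m y) z t =
    l2_2 x m (br_1 y z t) + l2_1 x m (br_2 y z t) +
    l2_2 x (l1_1 m z t) y + l2_1 x (l1_2 m z t) y +
    l2_2 (br_1 x z t) m y + l2_1 (br_2 x z t) m y;
  compat_bimod_identity3 : forall (x y z t : L) (m : M),
    l1_2 (l3_1 x y m) z t + l1_1 (l3_2 x y m) z t =
    l3_2 x y (l1_1 m z t) + l3_1 x y (l1_2 m z t) +
    l3_2 x (br_1 y z t) m + l3_1 x (br_2 y z t) m +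
    l3_2 (br_1 x z t) y m + l3_1 (br_2 x z t) y m;
  compat_bimod_identity4 : forall (x y z t : L) (m : M),
    l2_2 (br_1 x y z) m t + l2_1 (br_2 x y z) m t =
    l3_2 x y (l2_1 z m t) + l3_1 x y (l2_2 z m t) +
    l2_2 x (l2_1 y m t) z + l2_1 x (l2_2 y m t) z +
    l1_2 (l2_1 x m t) y z + l1_1 (l2_2 x m t) y z;
  compat_bimod_identity5 : forall (x y z t : L) (m : M),
    l3_2 (br_1 x y z) t m + l3_1 (br_2 x y z) t m =
    l3_2 x y (l3_1 z t m) + l3_1 x y (l3_2 z t m) +
    l2_2 x (l3_1 y t m) z + l2_1 x (l3_2 y t m) z +
    l1_2 (l3_1 x t m) y z + l1_1 (l3_2 x t m) y z
}.

(* The direct sum of L and M is the product vector space [L * M], and x + m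
   is the pair (x, m). *)
Definition direct_sum_bracket (K : fieldType) (L M : lmodType K)
    (br : L -> L -> L -> L)
    (l1 : M -> L -> L -> M) (l2 : L -> M -> L -> M) (l3 : L -> L -> M -> M)
    (a b c : L * M) : L * M :=
  let: (x, m1) := a in let: (y, m2) := b in let: (z, m3) := c in
  (br x y z, l1 m1 y z + l2 x m2 z + l3 x y m3).

(* Main.v *)
Require Import Defs.
From HB Require Import structures.
From mathcomp Require Import all_boot all_order all_algebra.

(** Evaluate a composite of two direct-sum brackets on x + m1, y + m2, z + m3,
    t + m4, u + m5.  Its L-component is the same composite of the brackets of
    L.  Its M-component is, by additivity of the actions in their module slot,
    a sum of five terms, the k-th of which depends on mk alone: in a composite
    with two or more entries from M, some bracket would take two arguments in
    M, and such brackets vanish.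

    Hence both the Leibniz identity and the compatibility identity on the
    direct sum split into six separate identities, one for each choice of the
    entry that lies in M, or of none.  With no entry in M this is the identity
    of L, and with the k-th entry in M it is the k-th bimodule identity.

    The four kinds of composite in the identities are computed in
    [direct_sum_bracket_nest_outer], [direct_sum_bracket_nest3],
    [direct_sum_bracket_nest2] and [direct_sum_bracket_nest1], with possibly
    different structures for the inner and the outer bracket.  Equal structures
    give the Leibniz identity, different ones the compatibility identity. *)

Set Implicit Arguments.
Unset Strict Implicit.
Unset Printing Implicit Defensive.

Import GRing.Theory.
Local Open Scope ring_scope.

Lemma addr5ACA (V : zmodType) (a1 a2 a3 a4 a5 b1 b2 b3 b4 b5 : V) :
  (a1 + a2 + a3 + a4 + a5) + (b1 + b2 + b3 + b4 + b5) =
  (a1 + b1) + (a2 + b2) + (a3 + b3) + (a4 + b4) + (a5 + b5).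
Proof. by do 3! (rewrite addrACA; congr (_ + _)); rewrite addrACA. Qed.

Section Trilinear.

Variables (K : fieldType) (U V W X : lmodType K) (f : U -> V -> W -> X).
Hypothesis f_lin : trilinear f.

Lemma trilinearD1 v w : {morph (fun u => f u v w) : u u' / u + u'}.
Proof. by case: f_lin => H _ _ u u'; have := H v w 1 u u'; rewrite !scale1r. Qed.

Lemma trilinearD2 u w : {morph (fun v => f u v w) : v v' / v + v'}.
Proof. by case: f_lin => _ H _ v v'; have := H u w 1 v v'; rewrite !scale1r. Qed.

Lemma trilinearD3 u v : {morph (fun w => f u v w) : w w' / w + w'}.
Proof. by case: f_lin => _ _ H w w'; have := H u v 1 w w'; rewrite !scale1r. Qed.

End Trilinear.

Lemma direct_sum_bracket_trilinear (K : fieldType) (L M : lmodType K)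
    (br : L -> L -> L -> L)
    (l1 : M -> L -> L -> M) (l2 : L -> M -> L -> M) (l3 : L -> L -> M -> M) :
  trilinear br -> trilinear l1 -> trilinear l2 -> trilinear l3 ->
  trilinear (U := (L * M)%type) (V := (L * M)%type) (W := (L * M)%type)
    (X := (L * M)%type) (direct_sum_bracket br l1 l2 l3).
Proof.
have regroup (a : K) (A B C A' B' C' : M) :
    (a *: A + A') + (a *: B + B') + (a *: C + C') =
    a *: (A + B + C) + (A' + B' + C').
  by rewrite !scalerDr [X in X + _ = _]addrACA [LHS]addrACA.
move=> [b1 b2 b3] [l11 l12 l13] [l21 l22 l23] [l31 l32 l33].
split=> -[p n] [q o] a [x m] [y m'].
- by congr pair; rewrite /= ?b1 // l11 l21 l31 regroup.
- by congr pair; rewrite /= ?b2 // l12 l22 l32 regroup.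
- by congr pair; rewrite /= ?b3 // l13 l23 l33 regroup.
Qed.

(** * Composites of two direct-sum brackets *)

Section Composites.

Variables (K : fieldType) (L M : lmodType K).
Variables (br br' : L -> L -> L -> L).
Variables (l1 l1' : M -> L -> L -> M) (l2 l2' : L -> M -> L -> M).
Variables (l3 l3' : L -> L -> M -> M).
Hypotheses (l1'_lin : trilinear l1') (l2'_lin : trilinear l2').
Hypothesis l3'_lin : trilinear l3'.

Local Notation B := (direct_sum_bracket br l1 l2 l3).
Local Notation B' := (direct_sum_bracket br' l1' l2' l3').

Lemma direct_sum_bracket_nest_outer x y z t u m1 m2 m3 m4 m5 :
  B' (B (x, m1) (y, m2) (z, m3)) (t, m4) (u, m5) =
  (br' (br x y z) t u,
   l1' (l1 m1 y z) t u + l1' (l2 x m2 z) t u + l1' (l3 x y m3) t u +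
   l2' (br x y z) m4 u + l3' (br x y z) t m5).
Proof. by rewrite /= !(trilinearD1 l1'_lin). Qed.

Variables (x y z t u : L) (m1 m2 m3 m4 m5 : M).

Lemma direct_sum_bracket_nest3 :
  B' (x, m1) (y, m2) (B (z, m3) (t, m4) (u, m5)) =
  (br' x y (br z t u),
   l1' m1 y (br z t u) + l2' x m2 (br z t u) + l3' x y (l1 m3 t u) +
   l3' x y (l2 z m4 u) + l3' x y (l3 z t m5)).
Proof. by rewrite /= !(trilinearD3 l3'_lin) !addrA. Qed.

Lemma direct_sum_bracket_nest2 :
  B' (x, m1) (B (y, m2) (t, m4) (u, m5)) (z, m3) =
  (br' x (br y t u) z,
   l1' m1 (br y t u) z + l2' x (l1 m2 t u) z + l3' x (br y t u) m3 +
   l2' x (l2 y m4 u) z + l2' x (l3 y t m5) z).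
Proof.
rewrite /= !(trilinearD2 l2'_lin) !addrA; congr (_, _).
by rewrite [LHS]addrAC; congr (_ + _); rewrite [LHS]addrAC.
Qed.

(** This is the same composite as in [direct_sum_bracket_nest_outer], with the terms
    arranged for the order m1, ..., m5 in which it enters the right-hand side of
    the Leibniz identity. *)
Lemma direct_sum_bracket_nest1 :
  B' (B (x, m1) (t, m4) (u, m5)) (y, m2) (z, m3) =
  (br' (br x t u) y z,
   l1' (l1 m1 t u) y z + l2' (br x t u) m2 z + l3' (br x t u) y m3 +
   l1' (l2 x m4 u) y z + l1' (l3 x t m5) y z).
Proof.
rewrite direct_sum_bracket_nest_outer; congr (_, _).
by rewrite -!addrA; congr (_ + _); rewrite [LHS]addrA [LHS]addrC !addrA.
Qed.

End Composites.

(** * The direct sum as a compatible ternary Leibniz algebra *)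

Lemma direct_sum_ternary_leibniz (K : fieldType) (L M : lmodType K)
    (br : L -> L -> L -> L)
    (l1 : M -> L -> L -> M) (l2 : L -> M -> L -> M) (l3 : L -> L -> M -> M) :
  ternary_leibniz br -> leibniz_bimodule br l1 l2 l3 ->
  ternary_leibniz (L := (L * M)%type) (direct_sum_bracket br l1 l2 l3).
Proof.
move=> [brT brI] [T1 T2 T3 I1 I2 I3 I4 I5].
split; first exact: direct_sum_bracket_trilinear.
move=> [x m1] [y m2] [z m3] [t m4] [u m5].
(* Restricted to the left-hand side, since the last composite on the right-hand
   side has the same shape but is to be expanded in the order m1, ..., m5. *)
rewrite [in LHS]direct_sum_bracket_nest_outer // direct_sum_bracket_nest3 //.
rewrite direct_sum_bracket_nest2 // direct_sum_bracket_nest1 //.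
congr pair; first exact: brI.
(* The innermost sums go first: the five terms of an inner summand are matched
   only while that summand is isolated by the rewrite context. *)
rewrite /= [X in _ = X + _]addr5ACA [RHS]addr5ACA.
congr (_ + _ + _ + _ + _);
  [exact: I1 | exact: I2 | exact: I3 | exact: I4 | exact: I5].
Qed.

Theorem proposition4p1 (K : fieldType) (L M : lmodType K)
    (br_1 br_2 : L -> L -> L -> L)
    (l1_1 : M -> L -> L -> M) (l2_1 : L -> M -> L -> M)
    (l3_1 : L -> L -> M -> M)
    (l1_2 : M -> L -> L -> M) (l2_2 : L -> M -> L -> M)
    (l3_2 : L -> L -> M -> M)
    (hL : compatible_ternary_leibniz br_1 br_2)
    (hM : compatible_bimodule br_1 br_2 l1_1 l2_1 l3_1 l1_2 l2_2 l3_2) :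
  compatible_ternary_leibniz (L := (L * M)%type)
    (direct_sum_bracket br_1 l1_1 l2_1 l3_1)
    (direct_sum_bracket br_2 l1_2 l2_2 l3_2).
Proof.
case: hL => leib_1 leib_2 brI; case: hM => bim_1 bim_2 I1 I2 I3 I4 I5.
split; [exact: direct_sum_ternary_leibniz | exact: direct_sum_ternary_leibniz |].
case: bim_1 bim_2 => T1_1 T2_1 T3_1 _ _ _ _ _ [T1_2 T2_2 T3_2 _ _ _ _ _].
move=> [x m1] [y m2] [z m3] [t m4] [u m5].
rewrite ![in LHS]direct_sum_bracket_nest_outer // !direct_sum_bracket_nest3 //.
rewrite !direct_sum_bracket_nest2 // !direct_sum_bracket_nest1 //.
congr pair; first exact: brI.
rewrite /= [LHS]addr5ACA.
rewrite [X in _ = X + _ + _ + _ + _]addr5ACA [X in _ = X + _ + _ + _]addr5ACA.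
rewrite [X in _ = X + _ + _]addr5ACA [X in _ = X + _]addr5ACA [RHS]addr5ACA.
congr (_ + _ + _ + _ + _);
  [exact: I1 | exact: I2 | exact: I3 | exact: I4 | exact: I5].
Qed.
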